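(* Let $H$ be a separable real Hilbert space with norm $|\cdot|$, and let $A$ be a nonnegative self-adjoint (possibly unbounded) linear operator on $H$ with dense domain $D(A)$. Let $m:[0,+\infty)\to[0,+\infty)$ be a continuous function. Let $b:[0,+\infty)\to(0,+\infty)$ be a continuous function such that $$\int_{0}^{+\infty}b(s)\,ds<+\infty.$$ Let $(u_{0},u_{1})\in D(A)\times D(A^{1/2})$ be such that $$|u_{1}|^{2}+\int_{0}^{|A^{1/2}u_{0}|^{2}}m(\sigma)\,d\sigma>0.$$ Assume that for some $\varepsilon>0$ the Cauchy problem $$\varepsilon u_{\varepsilon}''(t)+b(t)u_{\varepsilon}'(t)+m\left(|A^{1/2}u_{\varepsilon}(t)|^{2}\right)Au_{\varepsilon}(t)=0\quad\text{for all } t\geq 0,$$ $$u_{\varepsilon}(0)=u_{0},\qquad u_{\varepsilon}'(0)=u_{1},$$ has a global solution $$u_{\varepsilon}\in C^{2}([0,+\infty);H)\cap C^{1}([0,+\infty);D(A^{1/2}))\cap C^{0}([0,+\infty);D(A)).$$ Then $$\liminf_{t\to+\infty}\left(|u_{\varepsilon}'(t)|^{2}+|A^{1/2}u_{\varepsilon}(t)|^{2}\right)>0.$$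
   Context: $\langle\cdot,\cdot\rangle$ and $|\cdot|$ denote the scalar product and the norm of $H$. The operator $A$ is nonnegative, meaning $\langle Ax,x\rangle\geq 0$ for every $x\in D(A)$. For $\alpha\geq 0$, $A^{\alpha}$ denotes the power of $A$ (defined by the spectral theorem) with domain $D(A^{\alpha})$; the spaces $D(A^{\alpha})$ carry the graph norm. Primes denote derivatives with respect to $t$. *)

(* Defs.v *)
From HB Require Import structures.
From mathcomp Require Import all_boot all_order all_algebra.
From mathcomp Require Import sesquilinear.
From mathcomp Require Import all_classical all_reals all_analysis.

Set Implicit Arguments.
Unset Strict Implicit.
Unset Printing Implicit Defensive.
Import Order.TTheory GRing.Theory Num.Theory.
Import numFieldNormedType.Exports.

Local Open Scope classical_set_scope.
Local Open Scope ring_scope.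

(* A real Hilbert space is a complete normed space [H] together with a dot
   product [ip : {dot H for idfun}] that induces its norm. *)
Definition induces_norm (R : realType) (H : completeNormedModType R)
    (ip : {dot H for idfun}) : Prop :=
  forall x : H, `|x| = Num.sqrt (ip x x).

Definition separable (T : topologicalType) : Prop :=
  exists S : set T, countable S /\ dense S.

(* The values of [op_fun] outside [op_dom] are meaningless. *)
Record linear_operator (R : realType) (H : completeNormedModType R) := {
  op_dom : set H;
  op_fun :> H -> H;
  op_dom0 : op_dom 0;
  op_domP : forall (a : R) (x y : H),
    op_dom x -> op_dom y -> op_dom (a *: x + y);
  op_linear : forall (a : R) (x y : H),
    op_dom x -> op_dom y -> op_fun (a *: x + y) = a *: op_fun x + op_fun y
}.

Section Operators.
Variables (R : realType) (H : completeNormedModType R).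
Variable ip : {dot H for idfun}.

(* [adjoint_graph T y z] says that [y] is in D(T^* ) and [z = T^* y]
   (for a densely defined [T]). *)
Definition adjoint_graph (T : linear_operator H) (y z : H) : Prop :=
  forall x, op_dom T x -> ip (T x) y = ip x z.

Definition self_adjoint (T : linear_operator H) : Prop :=
  dense (op_dom T) /\
  forall y z, adjoint_graph T y z <-> (op_dom T y /\ z = T y).

Definition nonnegative_op (T : linear_operator H) : Prop :=
  forall x, op_dom T x -> 0 <= ip (T x) x.

End Operators.

(* Resolutions of the identity on the Borel sets of the real line. The values
   of [pvm] at non-Borel sets are meaningless. *)
Record resolution_of_identity (R : realType) (H : completeNormedModType R)
    (ip : {dot H for idfun}) := {
  pvm :> set (measurableTypeR R) -> H -> H;
  pvm_linear : forall B, measurable B ->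
    forall (a : R) (x y : H), pvm B (a *: x + y) = a *: pvm B x + pvm B y;
  pvm_sym : forall B, measurable B ->
    forall x y : H, ip (pvm B x) y = ip x (pvm B y);
  pvm0 : forall x, pvm set0 x = 0;
  pvmT : forall x, pvm setT x = x;
  pvmI : forall B C, measurable B -> measurable C ->
    forall x, pvm (B `&` C) x = pvm B (pvm C x);
  pvm_sigma_additive : forall x y : H,
    semi_sigma_additive (fun B => (ip (pvm B x) y)%:E)
}.

Section Spectral.
Variables (R : realType) (H : completeNormedModType R).
Variable ip : {dot H for idfun}.
Variable E : resolution_of_identity ip.

(* On Borel sets [ip (E B x) (E B x) = ip (E B x) x]; the left-hand side is
   used because it is nonnegative at every set. *)
Definition spectral_measure (x : H) (B : set (measurableTypeR R)) : \bar R :=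
  (ip (E B x) (E B x))%:E.

Lemma spectral_measureE (x : H) (B : set (measurableTypeR R)) :
  measurable B -> spectral_measure x B = (ip (E B x) x)%:E.
Proof.
move=> mB; rewrite /spectral_measure (pvm_sym E mB) -(pvmI E mB mB) setIid.
by rewrite -(pvm_sym E mB).
Qed.

Let spectral_measure0 (x : H) : spectral_measure x set0 = 0%E.
Proof. by rewrite /spectral_measure (pvm0 E) linear0l. Qed.

Let spectral_measure_ge0 (x : H) B : (0 <= spectral_measure x B)%E.
Proof.
rewrite /spectral_measure lee_fin.
have [->|/(neq0_dnorm_gt0 (s := ip))/ltW//] := eqVneq (E B x) 0.
by rewrite linear0l.
Qed.

Let spectral_measure_sigma_additive (x : H) :
  semi_sigma_additive (spectral_measure x).
Proof.
move=> F mF tF mUF; rewrite spectral_measureE//.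
under eq_fun do under eq_bigr do rewrite spectral_measureE//.
exact: pvm_sigma_additive.
Qed.

HB.instance Definition _ (x : H) := isMeasure.Build _ _ _ (spectral_measure x)
  (spectral_measure0 x) (spectral_measure_ge0 x)
  (@spectral_measure_sigma_additive x).

(* [T] is the integral of the real function [f] with respect to [E]: its domain
   consists of the [x] such that [f] is square integrable for <E x, x>, and
   <T x, y> is the integral of [f] for the signed measure <E x, y>, written
   through the polarization identity
   4 <E x, y> = <E(x + y), x + y> - <E(x - y), x - y>. *)
Definition spectral_integral (f : R -> R) (T : linear_operator H) : Prop :=
  (forall x, op_dom T x <->
     (\int[spectral_measure x]_l ((f l) ^+ 2)%:E < +oo)%E) /\
  (forall x y, op_dom T x -> op_dom T y ->
     ip (T x) y = (\int[spectral_measure (x + y)]_l (f l)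
                   - \int[spectral_measure (x - y)]_l (f l)) / 4).

End Spectral.

(* For [a >= 0], [B] is [A^a], as given by the spectral theorem for the nonnegative
   self-adjoint operator [A]. As [A] is nonnegative, its resolution of the
   identity vanishes on the negative reals, so the values that [powR] takes
   there are irrelevant. *)
Definition is_power (R : realType) (H : completeNormedModType R)
    (ip : {dot H for idfun}) (A : linear_operator H) (a : R)
    (B : linear_operator H) : Prop :=
  exists E : resolution_of_identity ip,
    spectral_integral E (fun l => l) A /\
    spectral_integral E (fun l => l `^ a) B.

Section Regularity.
Variables (R : realType) (H : completeNormedModType R).

(* A subspace of [H] with its own norm. *)
Record normed_subspace := { ns_dom : set H; ns_norm : H -> R }.

Definition whole_space : normed_subspace :=
  {| ns_dom := setT; ns_norm := fun x => `|x| |}.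

Definition graph_space (T : linear_operator H) : normed_subspace :=
  {| ns_dom := op_dom T; ns_norm := fun x => `|x| + `|T x| |}.

Implicit Types (X : normed_subspace) (u v : R -> H).

(* Functions on the half-line are represented by total functions whose values
   at negative times are meaningless; limits are taken within [0, +oo[. *)
Definition continuous_half X u : Prop :=
  forall t, 0 <= t -> ns_dom X (u t) /\
    ns_norm X (u s - u t) @[s --> within `[0, +oo[ (nbhs t)] --> (0 : R).

Definition is_derive_half X u v : Prop :=
  forall t, 0 <= t -> ns_dom X (u t) /\ ns_dom X (v t) /\
    ns_norm X ((s - t)^-1 *: (u s - u t) - v t)
      @[s --> within `[0, +oo[ t^'] --> (0 : R).

Fixpoint Ck_half (k : nat) X u : Prop :=
  if k is k'.+1 then exists2 v, is_derive_half X u v & Ck_half k' X v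
  else continuous_half X u.

Definition derive_half u (t : R) : H :=
  lim ((s - t)^-1 *: (u s - u t) @[s --> within `[0, +oo[ t^']).

End Regularity.

(* Main.v *)
Require Import Defs.
From HB Require Import structures.
From mathcomp Require Import all_boot all_order all_algebra.
From mathcomp Require Import sesquilinear.
From mathcomp Require Import all_classical all_reals all_analysis.
From mathcomp Require Import measurable_realfun.
From mathcomp Require Import ring lra.
Set Implicit Arguments.
Unset Strict Implicit.
Unset Printing Implicit Defensive.
Import Order.TTheory GRing.Theory Num.Theory.
Import numFieldNormedType.Exports.
Local Open Scope classical_set_scope.
Local Open Scope ring_scope.

(** Along a solution the energy
    [En t = eps * |u' t| ^ 2 + M (|A^(1/2) u t| ^ 2)], where [M] is the primitive
    of [m] vanishing at [0], satisfies
    [En' = - 2 b |u'| ^ 2 >= - (2 / eps) b En], because [m >= 0] makes the second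
    term of [En] nonnegative. Hence
    [En t >= En 0 * exp (- (2 / eps) * \int_0^t b)] (lemma
    [gronwall_lower_bound]), and, [b] being integrable, [En] stays above a
    positive constant as soon as [En 0 > 0], which is the nondegeneracy
    assumption. As [M] is continuous and vanishes at [0], the quantities
    [|u' t| ^ 2] and [|A^(1/2) u t| ^ 2] cannot both be small.

    The derivative of [|A^(1/2) u| ^ 2] is computed from the identity
    [|A^(1/2) x| ^ 2 - |A^(1/2) y| ^ 2 = <x - y, A x + A y>] (lemma
    [sqrt_op_sub]), applied to [x = u s] and [y = u t]: it only takes the
    differentiability of [u] in [H] and the continuity of [A u] to obtain
    [2 <u', A u>] (lemma [is_derive_quadratic]).

    The identity follows from the symmetry of [A] and from
    [|A^(1/2) x| ^ 2 = <A x, x>] (lemma [sqrt_op_quad]), a fact about spectral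
    integrals. The operator [B], integral of [f >= 0] with respect to the
    resolution of the identity [E], is given by [<B x, z>], the integral of [f]
    for the signed measure
    [C |-> <E C x, z>]. For [z = E C x] this measure is [mu_x], the spectral
    measure of [x], restricted to [C]; hence
    [<B x, E C x> = \int_C f dmu_x]. For [z = E C (B x)], with [f] bounded on
    [C], the signed measure is therefore the positive measure of density [f 1_C]
    with respect to [mu_x], so that
    [|E C (B x)| ^ 2 = <B x, E C (B x)> = \int_C f ^ 2 dmu_x]. Letting [C] grow
    yields [|B x| ^ 2 = \int f ^ 2 dmu_x] (lemma [spectral_integral_norm]).
    For [f] the square root, [f ^ 2] is the identity on the nonnegative reals,
    which carry the spectral measures of a nonnegative operator (lemma
    [spectral_measure_neg]). *)

(** * Measures with a density *)

Section Density.
Local Open Scope ereal_scope.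
Context {d : measure_display} {T : measurableType d} {R : realType}.
Variables (mu : {measure set T -> \bar R}) (g : T -> R).
Hypotheses (g_meas : measurable_fun setT g) (g_ge0 : forall x, (0 <= g x)%R).

(** The measure with density [g] with respect to [mu]. The two unused arguments
    let the measure structure be inferred from the term itself. *)
Definition density (_ : measurable_fun setT g) (_ : forall x, (0 <= g x)%R)
  (C : set T) : \bar R := \int[mu]_(x in C) (g x)%:E.

Local Notation nu := (density g_meas g_ge0).

Let density0 : nu set0 = 0.
Proof. exact: integral_set0. Qed.

Let density_ge0 C : 0 <= nu C.
Proof. by apply: integral_ge0 => x _; rewrite lee_fin. Qed.

Let density_sigma_additive : semi_sigma_additive nu.
Proof.
move=> F mF tF mUF; apply: (@semi_sigma_additive_nng_induced _ _ _ mu) => //.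
  exact/measurable_EFinP.
Qed.

HB.instance Definition _ :=
  isMeasure.Build _ _ _ nu density0 density_ge0 density_sigma_additive.

Import HBNNSimple.

Let integral_density_nnsfun (h : {nnsfun T >-> R}) :
  \int[nu]_x (h x)%:E = \int[mu]_x (h x * g x)%:E.
Proof.
have mh y : measurable (h @^-1` [set y]) by exact: measurable_sfunP.
have hE x : (h x)%:E =
    \sum_(y \in range h) (y * \1_(h @^-1` [set y]) x)%:E.
  by rewrite fsumEFin// -fimfunE.
rewrite (eq_integral _ _ (fun x _ => hE x)).
rewrite ge0_integral_fsum//; last 2 first.
  - by move=> y; apply/measurable_EFinP; exact: measurable_funM.
  - by move=> y x _; rewrite EFinM nnfun_muleindic_ge0.
have hgE x : (h x * g x)%:E = \sum_(y \in range h)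
    (y * \1_(h @^-1` [set y]) x)%:E * (g x)%:E.
  rewrite EFinM hE ge0_mule_fsuml// => y.
  by rewrite EFinM nnfun_muleindic_ge0.
rewrite [RHS](eq_integral _ _ (fun x _ => hgE x)).
rewrite [RHS]ge0_integral_fsum//; last 2 first.
  - move=> y; apply: emeasurable_funM; apply/measurable_EFinP => //.
    exact: measurable_funM.
  - move=> y x _; apply: mule_ge0; last by rewrite lee_fin.
    by rewrite EFinM nnfun_muleindic_ge0.
apply: eq_fsbigr => y /set_mem[t _ <-].
under eq_integral do rewrite EFinM.
rewrite ge0_integralZl//; [|exact/measurable_EFinP|by rewrite lee_fin].
rewrite integral_indic// setIT.
under [RHS]eq_integral do rewrite EFinM -muleA.
rewrite ge0_integralZl//; last 3 first.
  - by apply: emeasurable_funM; apply/measurable_EFinP.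
  - by move=> x _; rewrite mule_ge0 ?lee_fin.
  - by rewrite lee_fin.
congr (_ * _); rewrite /= /density integral_mkcond.
apply: eq_integral => x _.
by rewrite epatch_indic muleC.
Qed.

(** By monotone convergence from simple functions [h] below [f]. *)
Lemma ge0_integral_density (f : T -> R) :
  measurable_fun setT f -> (forall x, (0 <= f x)%R) ->
  \int[nu]_x (f x)%:E = \int[mu]_x (f x * g x)%:E.
Proof.
move=> /measurable_EFinP mf f0; pose h := nnsfun_approx measurableT mf.
have nd_h x : {homo (fun n => (h n x)%:E) : m n / (m <= n)%N >-> m <= n}.
  by move=> m n mn; rewrite lee_fin; exact/lefP/nd_nnsfun_approx.
have cvg_h x : (h n x)%:E @[n --> \oo] --> (f x)%:E.
  by apply: cvg_nnsfun_approx => // y _; rewrite lee_fin.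
transitivity (limn (fun n => \int[nu]_x (h n x)%:E)).
  rewrite -monotone_convergence//.
  - by apply: eq_integral => x _; apply/esym/cvg_lim.
  - by move=> n; apply/measurable_EFinP.
  - by move=> n x _; rewrite lee_fin.
under eq_fun do rewrite integral_density_nnsfun.
rewrite -monotone_convergence//.
- apply: eq_integral => x _; apply/cvg_lim => //.
  by rewrite EFinM; under eq_fun do rewrite EFinM; apply: cvgeZr.
- by move=> n; apply/measurable_EFinP/measurable_funM.
- by move=> n x _; rewrite lee_fin mulr_ge0.
- move=> x _ m n mn; rewrite !EFinM lee_wpmul2r ?lee_fin ?g_ge0//.
  exact/lefP/nd_nnsfun_approx.
Qed.

End Density.

(** * Inner products and spectral measures *)

Section InnerProduct.
Variables (R : realType) (H : completeNormedModType R).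
Variable ip : {dot H for idfun}.

Lemma dotC x y : ip x y = ip y x.
Proof. by rewrite hermC expr0 mul1r. Qed.

Lemma dot_ge0 x : 0 <= ip x x.
Proof.
have [->|/(neq0_dnorm_gt0 (s := ip))/ltW//] := eqVneq x 0.
by rewrite linear0l.
Qed.

Lemma dotDl x y z : ip (x + y) z = ip x z + ip y z.
Proof. by rewrite linearDl. Qed.

Lemma dotNl x z : ip (- x) z = - ip x z.
Proof. by rewrite linearNl. Qed.

Lemma dotDr z x y : ip z (x + y) = ip z x + ip z y.
Proof. by rewrite !(dotC z) dotDl. Qed.

Lemma dotNr z x : ip z (- x) = - ip z x.
Proof. by rewrite !(dotC z) dotNl. Qed.

Lemma dot_sqr_sub x y : ip x x - ip y y = ip (x - y) (x + y).
Proof. by rewrite dotDl dotNl !dotDr [ip y x]dotC; ring. Qed.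

Hypothesis ip_norm : induces_norm ip.

Lemma dotE x : ip x x = `|x| ^+ 2.
Proof. by rewrite ip_norm sqr_sqrtr ?dot_ge0. Qed.

End InnerProduct.

Section SpectralCalculus.
Variables (R : realType) (H : completeNormedModType R).
Variable ip : {dot H for idfun}.
Variable E : resolution_of_identity ip.
Implicit Types (x y z : H) (C D : set (measurableTypeR R)).

Local Notation mu := (spectral_measure E).

Lemma pvmD C x y : measurable C -> E C (x + y) = E C x + E C y.
Proof. by move=> mC; rewrite -[x]scale1r pvm_linear// !scale1r. Qed.

Lemma pvm_0r C : measurable C -> E C 0 = 0.
Proof. by move=> mC; apply: (addIr (E C 0)); rewrite -pvmD// !add0r. Qed.

Lemma pvmN C x : measurable C -> E C (- x) = - E C x.
Proof.
move=> mC; rewrite -[- x]addr0 -scaleN1r pvm_linear//.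
by rewrite pvm_0r// addr0 scaleN1r.
Qed.

Lemma spectral_measureT x : mu x setT = (ip x x)%:E.
Proof. by rewrite /spectral_measure pvmT. Qed.

Lemma spectral_measure_pvm C x D : measurable C -> measurable D ->
  mu (E C x) D = mu x (C `&` D).
Proof. by move=> mC mD; rewrite /spectral_measure setIC pvmI. Qed.

(** [4 <E C x, z>] is the increment of the quadratic form [x |-> <E C x, x>]
    from [x - z] to [x + z]. *)
Lemma spectral_measure_polarization C x z : measurable C ->
  mu (x + z) C = (mu (x - z)%R C + (4 * ip (E C x) z)%:E)%E.
Proof.
move=> mC; rewrite /spectral_measure -EFinD; congr EFin.
rewrite !pvmD// pvmN//.
have -> : ip (E C x) z = ip (E C x) (E C z).
  by rewrite -pvm_sym// -pvmI// setIid.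
rewrite !dotDl !dotDr !(dotNl, dotNr) [ip (E C z) (E C x)]dotC; ring.
Qed.

(** The spectral measure of [E C x] is that of [x] restricted to [C]. *)
Lemma ge0_integral_spectral_measure_pvm C x (f : R -> R) : measurable C ->
  measurable_fun setT f -> (forall l, 0 <= f l) ->
  (\int[mu (E C x)]_l (f l)%:E = \int[mu x]_l (f l * \1_C l)%:E)%E.
Proof.
move=> mC mf f0.
have m1 : measurable_fun setT (\1_C : measurableTypeR R -> R) by [].
have g0 l : 0 <= \1_C l :> R by [].
rewrite -(@ge0_integral_density _ _ _ (mu x) _ m1 g0 f mf f0).
apply: eq_measure_integral => D mD _.
transitivity (mu x (C `&` D)); first exact: spectral_measure_pvm.
by rewrite /= /density integral_indic.
Qed.

(** Spectral measures are finite, so square integrability gives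
    integrability, by [f <= 1 + f ^ 2]. *)
Lemma spectral_measure_sqr_fin x (f : R -> R) :
  measurable_fun setT f -> (forall l, 0 <= f l) ->
  (\int[mu x]_l (f l ^+ 2)%:E < +oo)%E ->
  (\int[mu x]_l (f l)%:E)%E \is a fin_num.
Proof.
move=> mf f0 fx.
rewrite ge0_fin_numE; last by apply: integral_ge0 => l _; rewrite lee_fin.
apply: (@le_lt_trans _ _ (\int[mu x]_l (cst 1%:E l + (f l ^+ 2)%:E)))%E.
  apply: ge0_le_integral => //.
  - by move=> l _; rewrite lee_fin.
  - exact/measurable_EFinP.
  - apply: emeasurable_funD => //; apply/measurable_EFinP.
    exact: measurable_funX.
  - move=> l _; rewrite /= -EFinD lee_fin.
    have := sqr_ge0 (f l - 1); have := f0 l; nra.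
rewrite ge0_integralD//; last 2 first.
  - by move=> l _; rewrite lee_fin sqr_ge0.
  - by apply/measurable_EFinP; exact: measurable_funX.
rewrite integral_cst//= mul1e; apply: lte_add_pinfty => //.
by rewrite [X in (X < _)%E]spectral_measureT ltry.
Qed.

End SpectralCalculus.

(** * Spectral integrals of nonnegative functions *)

Section LinearOperator.
Variables (R : realType) (H : completeNormedModType R) (T : linear_operator H).
Implicit Types x y : H.

Lemma op_domD x y : op_dom T x -> op_dom T y -> op_dom T (x + y).
Proof. by move=> dx dy; rewrite -[x]scale1r; apply: op_domP. Qed.

Lemma op_domB x y : op_dom T x -> op_dom T y -> op_dom T (x - y).
Proof. by move=> dx dy; rewrite addrC -scaleN1r; apply: op_domP. Qed.

Lemma opD x y : op_dom T x -> op_dom T y -> T (x + y) = T x + T y.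
Proof. by move=> dx dy; rewrite -[x]scale1r op_linear// !scale1r. Qed.

Lemma opB x y : op_dom T x -> op_dom T y -> T (x - y) = T x - T y.
Proof.
by move=> dx dy; rewrite addrC -scaleN1r op_linear// scaleN1r addrC.
Qed.

End LinearOperator.

Section NonnegativeFunction.
Variables (R : realType) (H : completeNormedModType R).
Variable ip : {dot H for idfun}.
Variable E : resolution_of_identity ip.
Variables (f : R -> R) (B : linear_operator H).
Hypotheses (f_meas : measurable_fun setT f) (f_ge0 : forall l, 0 <= f l).
Hypothesis BE : spectral_integral E f B.
Implicit Types (x y z : H) (C D : set (measurableTypeR R)).

Local Notation mu := (spectral_measure E).

Lemma op_dom_integral_fin x : op_dom B x ->
  (\int[mu x]_l (f l)%:E)%E \is a fin_num.
Proof.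
by move=> /(BE.1 x).1; exact: spectral_measure_sqr_fin.
Qed.

(** The polarized definition of [<B x, z>], when the signed measure
    [C |-> <E C x, z>] happens to be a positive measure. *)
Lemma spectral_integral_dot (nu : {measure set (measurableTypeR R) -> \bar R})
    x z : op_dom B x -> op_dom B z ->
    (forall C, measurable C -> nu C = (ip (E C x) z)%:E) ->
  (ip (B x) z)%:E = (\int[nu]_l (f l)%:E)%E.
Proof.
move=> dx dz nuE.
have mf : measurable_fun setT (EFin \o f : measurableTypeR R -> \bar R).
  exact/measurable_EFinP.
have f0 (l : measurableTypeR R) : setT l -> (0 <= (EFin \o f) l)%E.
  by rewrite lee_fin.
have pol : (\int[mu (x + z)%R]_l (f l)%:E
    = \int[mu (x - z)%R]_l (f l)%:E + 4%:E * \int[nu]_l (f l)%:E)%E.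
  rewrite -(ge0_integral_mscale nu _ (4%:nng : {nonneg R}))//.
  rewrite -ge0_integral_measure_add//.
  apply: eq_measure_integral => C mC _.
  transitivity (mu (x - z)%R C + (4%:E * nu C))%E.
    by rewrite nuE// -EFinM; exact: spectral_measure_polarization.
  exact/esym/measure_addE.
rewrite (BE.2 x z dx dz) /Rintegral pol.
have := op_dom_integral_fin (op_domB dx dz).
have := op_dom_integral_fin (op_domD dx dz); rewrite pol.
case: (\int[mu (x - z)%R]_l _)%E => [r||]//.
case: (\int[nu]_l _)%E => [s _ _ /=||].
- by congr EFin; field.
- by rewrite gt0_muley.
- by rewrite gt0_muleNy.
Qed.

End NonnegativeFunction.

Section SpectralIntegralNorm.
Variables (R : realType) (H : completeNormedModType R).
Variable ip : {dot H for idfun}.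
Variable E : resolution_of_identity ip.
Variables (f : R -> R) (B : linear_operator H).
Hypotheses (f_meas : measurable_fun setT f) (f_ge0 : forall l, 0 <= f l).
Hypothesis BE : spectral_integral E f B.
Implicit Types (x y z : H) (C D : set (measurableTypeR R)).

Local Notation mu := (spectral_measure E).

Let f2_meas : measurable_fun setT (fun l : R => f l ^+ 2).
Proof. exact: measurable_funX. Qed.

Let f2_ge0 l : 0 <= f l ^+ 2.
Proof. exact: sqr_ge0. Qed.

(** [E C x] is in the domain of [B] as soon as [f] is square integrable on [C],
    whether [x] is in that domain or not. *)
Lemma op_dom_pvm C x : measurable C ->
  (\int[mu x]_l (f l ^+ 2 * \1_C l)%:E < +oo)%E -> op_dom B (E C x).
Proof.
by move=> mC fC; apply/BE.1; rewrite ge0_integral_spectral_measure_pvm.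
Qed.

Lemma op_dom_pvm_stable C x : measurable C -> op_dom B x -> op_dom B (E C x).
Proof.
move=> mC /(BE.1 x).1 fx; apply: op_dom_pvm => //.
apply: le_lt_trans fx; apply: ge0_le_integral => //.
- by move=> l _; rewrite lee_fin mulr_ge0.
- by apply/measurable_EFinP; apply: measurable_funM.
- exact/measurable_EFinP.
- by move=> l _; rewrite lee_fin ler_piMr// indicE lern1 leq_b1.
Qed.

Lemma spectral_integral_dot_pvm C x : measurable C -> op_dom B x ->
  (ip (B x) (E C x))%:E = (\int[mu x]_l (f l * \1_C l)%:E)%E.
Proof.
move=> mC dx; rewrite -ge0_integral_spectral_measure_pvm//.
apply: (spectral_integral_dot f_meas f_ge0 BE dx) => [|D mD].
  exact: op_dom_pvm_stable.
rewrite [LHS]spectral_measureE// -pvmI// setIC pvmI//.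
by rewrite pvm_sym// -pvmI// setIid dotC.
Qed.

(** [|B x| ^ 2] is the integral of [f ^ 2] for the spectral measure of [x]. *)
Lemma spectral_integral_norm x : op_dom B x ->
  (ip (B x) (B x))%:E = (\int[mu x]_l (f l ^+ 2)%:E)%E.
Proof.
move=> dx; pose C (n : nat) : set (measurableTypeR R) := [set l | f l <= n%:R].
have mC n : measurable (C n).
  rewrite -[C n]setTI; exact: measurable_fun_le.
(* [B x] need not be in the domain of [B], but [f] is bounded on [C n]. *)
have dC n : op_dom B (E (C n) (B x)).
  apply: op_dom_pvm => //.
  apply: (@le_lt_trans _ _ (\int[mu (B x)]_l (n%:R ^+ 2)%:E)%E).
    apply: ge0_le_integral => //.
    - by move=> l _; rewrite lee_fin mulr_ge0.
    - by apply/measurable_EFinP; apply: measurable_funM.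
    - move=> l _; rewrite lee_fin indicE.
      case: (boolP (l \in C n)) => [/set_mem/= fn|_]; last first.
        by rewrite mulr0 sqr_ge0.
      by rewrite mulr1 ler_pXn2r ?nnegrE.
  by rewrite integral_cst// [X in (_ * X)%E]spectral_measureT -EFinM ltry.
(* The measure [D |-> <E D x, E (C n) (B x)> = <B x, E (C n `&` D) x>] has density
   [f 1_(C n)] with respect to the spectral measure of [x]. *)
have BC n : mu (B x) (C n) = (\int[mu x]_l (f l ^+ 2 * \1_(C n) l)%:E)%E.
  have mg : measurable_fun setT (fun l : measurableTypeR R => f l * \1_(C n) l).
    by apply: measurable_funM.
  have g0 (l : measurableTypeR R) : 0 <= f l * \1_(C n) l by rewrite mulr_ge0.
  rewrite spectral_measureE// dotC.
  pose nu := density (mu x) mg g0.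
  rewrite (spectral_integral_dot (nu := nu) f_meas f_ge0 BE)//.
    rewrite ge0_integral_density//; apply: eq_integral => l _.
    by rewrite mulrA expr2.
  move=> D mD.
  rewrite -pvm_sym// -pvmI// dotC spectral_integral_dot_pvm//; last first.
    exact: measurableI.
  rewrite /= /density integral_mkcond; apply: eq_integral => l _.
  by rewrite epatch_indic -EFinM -mulrA indicI.
have CT : \bigcup_n C n = setT.
  apply/seteqP; split=> // l _; exists (Num.truncn (f l)).+1 => //=.
  exact/ltW/truncnS_gt.
have ndC : nondecreasing_seq C.
  move=> m n mn; apply/subsetPset => l /= /le_trans; apply.
  by rewrite ler_nat.
have lim1 : mu (B x) (C n) @[n --> \oo] --> mu (B x) setT.
  by rewrite -CT; apply: nondecreasing_cvg_mu => //; rewrite CT.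
have lim2 : mu (B x) (C n) @[n --> \oo] --> (\int[mu x]_l (f l ^+ 2)%:E)%E.
  have cvgC l : (f l ^+ 2 * \1_(C n) l)%:E @[n --> \oo] --> (f l ^+ 2)%:E.
    apply: cvg_near_cst; exists (Num.truncn (f l)).+1 => // n /= fn.
    rewrite indicE mem_set ?mulr1//=.
    by apply: le_trans (ltW (truncnS_gt _)) _; rewrite ler_nat.
  under eq_fun do rewrite BC.
  have -> : (\int[mu x]_l (f l ^+ 2)%:E =
      \int[mu x]_l limn (fun n => (f l ^+ 2 * \1_(C n) l)%:E))%E.
    by apply: eq_integral => l _; apply/esym/cvg_lim => //; exact: cvgC.
  apply: cvg_monotone_convergence => //.
  - by move=> n; apply/measurable_EFinP; apply: measurable_funM.
  - by move=> n l _; rewrite lee_fin mulr_ge0.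
  - move=> l _ m n mn; rewrite lee_fin ler_wpM2l// !indicE ler_nat.
    have [|_] := boolP (l \in C m); last by case: (l \in C n).
    by move=> /set_mem/(subsetPset _ _ (ndC _ _ mn))/mem_set->.
rewrite -(spectral_measureT E).
by apply: (cvg_unique _ lim1 lim2).
Qed.

End SpectralIntegralNorm.

(** * The square root of a nonnegative operator *)

Section SquareRoot.
Variables (R : realType) (H : completeNormedModType R).
Variable ip : {dot H for idfun}.
Variable E : resolution_of_identity ip.
Variables A Ahalf : linear_operator H.
Hypothesis AE : spectral_integral E (fun l => l) A.
Hypothesis A_ge0 : nonnegative_op ip A.
Implicit Types x : H.

Local Notation mu := (spectral_measure E).
Local Notation neg := (`]-oo, 0[%classic : set (measurableTypeR R)).

(** In the polarization identity for [<A x, x>] only the spectral measure of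
    [x + x], four times that of [x], remains. *)
Lemma spectral_integral_quad x : op_dom A x ->
  ip (A x) x = fine (\int[mu (x + x)%R]_l l%:E)%E / 4.
Proof.
move=> dx; rewrite (AE.2 x x dx dx) subrr /Rintegral.
rewrite [X in (_ - fine X) / 4](_ : _ = 0%E) ?subr0//.
rewrite (eq_measure_integral mzero) ?integral_measure_zero// => C mC _.
by rewrite /= /spectral_measure pvm_0r// linear0l.
Qed.

Let meas_id : measurable_fun setT (fun l : R => l).
Proof. exact: measurable_id. Qed.

(** Nonnegativity of [A] on the range of the spectral projection of the
    negative half-line forces the spectral measures to vanish there. *)
Lemma spectral_measure_neg x : op_dom A x -> mu (x + x) neg = 0%E.
Proof.
move=> dx; pose z := x + x.
have mN : measurable neg by [].
have dw : op_dom A (E neg x) by exact: (op_dom_pvm_stable meas_id AE).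
have wz : E neg x + E neg x = E neg z by rewrite /z pvmD.
pose p (l : R) := Num.max l 0; pose n (l : R) := Num.max (- l) 0.
have mp : measurable_fun setT p by exact: measurable_maxr.
have mn : measurable_fun setT n.
  by apply: measurable_maxr => //; exact: measurableT_comp.
have p0 l : 0 <= p l by rewrite /p le_max lexx orbT.
have n0 l : 0 <= n l by rewrite /n le_max lexx orbT.
have pE : (\int[mu (E neg z)]_l (p l)%:E = 0)%E.
  rewrite ge0_integral_spectral_measure_pvm//; apply: integral0_eq => l _.
  rewrite indicE; case: (boolP (l \in neg)) => [/set_mem/=|_]; last first.
    by rewrite mulr0.
  by rewrite in_itv/= => /ltW l0; rewrite /p max_r// mul0r.
have nfin : (\int[mu (E neg z)]_l (n l)%:E)%E \is a fin_num.
  apply: spectral_measure_sqr_fin => //.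
  have /(AE.1 _).1 : op_dom A (E neg z) by rewrite -wz; exact: op_domD.
  apply: le_lt_trans; apply: ge0_le_integral => //.
  - by move=> l _; rewrite lee_fin sqr_ge0.
  - by apply/measurable_EFinP; exact: measurable_funX.
  - by apply/measurable_EFinP; exact: measurable_funX.
  - move=> l _; rewrite lee_fin /n; have [_|_] := leP (- l) 0.
      by rewrite expr0n sqr_ge0.
    by rewrite sqrrN.
(* [0 <= <A w, w>] with [w = E neg x] says that minus the integral of the
   negative part of [l] is nonnegative. *)
have n_eq0 : (\int[mu (E neg z)]_l (n l)%:E = 0)%E.
  have := A_ge0 dw; rewrite spectral_integral_quad// wz integralE.
  rewrite [X in (X - _)%E](_ : _ = 0%E); last first.
    rewrite -[RHS]pE; apply: eq_integral => l _.
    by rewrite funeposE /p EFin_max.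
  rewrite [X in (_ - X)%E](_ : _ = \int[mu (E neg z)]_l (n l)%:E)%E; last first.
    by apply: eq_integral => l _; rewrite funenegE /n EFin_max.
  have : (0 <= \int[mu (E neg z)]_l (n l)%:E)%E.
    by apply: integral_ge0 => l _; rewrite lee_fin.
  move: nfin; case: (\int[_]_l _)%E => [r _||]//=.
  rewrite lee_fin => r0 rN; congr EFin; lra.
move: n_eq0; rewrite ge0_integral_spectral_measure_pvm// => n_eq0.
have [] := ae_eq_integral_abs (mu z) measurableT
  (f := fun l => (n l * \1_neg l)%:E).
  by apply/measurable_EFinP; apply: measurable_funM.
move=> + _; have -> : (\int[mu z]_l `|(n l * \1_neg l)%:E| = 0)%E.
  rewrite -[RHS]n_eq0; apply: eq_integral => l _.
  by rewrite gee0_abs// lee_fin mulr_ge0.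
move=> /(_ erefl) [N [mN' N0 subN]].
apply/eqP; rewrite -measure_le0 -N0.
apply: le_measure; rewrite ?inE// => l; rewrite /= in_itv/= => l0.
apply: subN => /= /(_ I); rewrite indicE mem_set/= ?in_itv//= mulr1.
by move=> [] /eqP; rewrite /n max_l ?oppr_eq0 ?lt_eqF// oppr_ge0 ltW.
Qed.

Hypothesis AhalfE : spectral_integral E (fun l => l `^ 2^-1) Ahalf.

(** At a negative [l] the power [l `^ 2^-1] has a spurious value, which is
    harmless by [spectral_measure_neg]. *)
Lemma sqrt_op_quad x : op_dom A x -> op_dom Ahalf x ->
  ip (Ahalf x) (Ahalf x) = ip (A x) x.
Proof.
move=> dx dhx.
have mf : measurable_fun setT (fun l : R => l `^ 2^-1).
  exact: measurable_powR.
have f0 (l : R) : 0 <= l `^ 2^-1 by exact: powR_ge0.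
have := spectral_integral_norm mf f0 AhalfE (op_domD dhx dhx).
have -> : (\int[mu (x + x)%R]_l ((l `^ 2^-1) ^+ 2)%:E =
    \int[mu (x + x)%R]_l l%:E)%E.
  apply: ae_eq_integral => //.
  - by apply/measurable_EFinP; exact: measurable_funX.
  - exists neg; split=> //; first exact: spectral_measure_neg.
    move=> l /= lE; rewrite in_itv/= ltNge; apply/negP => l0; apply: lE => _.
    by rewrite powR12_sqrt// sqr_sqrtr.
rewrite spectral_integral_quad// => <-/=.
by rewrite opD// !dotDl !dotDr; field.
Qed.

End SquareRoot.

(** Increments of [|A^(1/2) x| ^ 2], in terms of [A] alone. *)
Lemma sqrt_op_sub (R : realType) (H : completeNormedModType R)
    (ip : {dot H for idfun}) (A Ahalf : linear_operator H) :
  self_adjoint ip A -> nonnegative_op ip A -> is_power ip A (2^-1) Ahalf ->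
  forall x y, op_dom A x -> op_dom Ahalf x -> op_dom A y -> op_dom Ahalf y ->
  ip (Ahalf x) (Ahalf x) - ip (Ahalf y) (Ahalf y) = ip (x - y) (A x + A y).
Proof.
move=> [_ A_sa] A_ge0 [E [AE AhalfE]] x y dx dhx dy dhy.
rewrite !(sqrt_op_quad AE A_ge0 AhalfE)//.
have /A_sa/(_ x dx) Axy : op_dom A y /\ A y = A y by [].
rewrite dotDl dotNl !dotDr -Axy [ip (A y) y]dotC [ip y (A x)]dotC.
by rewrite [ip (A x) x]dotC; ring.
Qed.

(** * Real functions and the half-line *)

Section RealCalculus.
Variable R : realType.
Implicit Types (f g : R -> R) (t : R).

Lemma is_derive_difference_quotient g t (d : R) :
  (s - t)^-1 * (g s - g t) @[s --> t^'] --> d -> is_derive t 1 g d.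
Proof.
move=> gd.
have lim_d : (h^-1 *: ((g \o shift t) (h *: (1 : R)) - g t)) @[h --> 0^'] --> d.
  apply/cvgrPdist_lt => e e0.
  move/cvgrPdist_lt : gd => /(_ e e0)[r /= r0 gr].
  exists r => //= h /=; rewrite sub0r normrN => hr h0.
  have := gr (h + t); rewrite /= opprD addrCA subrr addr0 normrN => /(_ hr).
  have htt : h + t != t by rewrite -subr_eq0 addrK.
  by move=> /(_ htt); rewrite addrK [h *: 1]mulr1.
by apply: DeriveDef; [exact: (cvgP d)|exact: cvg_lim].
Qed.

Lemma half_line_dnbhs t : 0 < t -> within `[0, +oo[ t^' = t^'.
Proof.
move=> t0; apply/seteqP; split=> W; last exact: cvg_within.
have t_nbhs : \forall s \near t^', 0 <= s.
  by apply: nbhs_dnbhs; near do apply/ltW; exact: lt_nbhsr.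
by apply: filterS2 t_nbhs => s s0; apply; rewrite /= in_itv/= s0.
Unshelve. all: by end_near. Qed.

(** A continuous function on the half-line has a primitive on it, which can be
    extended so as to be differentiable at [0] as well; the chain rule needs this
    where a nonnegative inner function vanishes. *)
Lemma half_line_primitive g : {within `[0, +oo[, continuous g} ->
  exists2 G : R -> R, forall x : R, 0 <= x -> is_derive x 1 G (g x) &
    forall x : R, 0 <= x -> G x = \int[lebesgue_measure]_(s in `[0, x]) g s.
Proof.
(* [h] extends [g] by the constant [g 0], so that [0] is an interior point. *)
move=> gc; pose h (x : R) := g (Num.max x 0).
have hg (x : R) : 0 <= x -> h x = g x by move=> x0; rewrite /h max_l.
have max_cont : continuous (fun x : R => Num.max x 0).
  move=> x; have maxE (y : R) : Num.max y 0 = (y + `|y|) / 2.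
    by rewrite maxr_absE addr0 subr0.
  rewrite /continuous_at maxE; under eq_fun do rewrite maxE.
  by apply: cvgMl; apply: cvgD; [exact: cvg_id|apply: cvg_norm; exact: cvg_id].
have h_cont : continuous h.
  move=> x; have max0 y : `[0, +oo[%classic (Num.max y (0 : R)).
    by rewrite /= in_itv/= le_max lexx orbT.
  have /subspace_continuousP/(_ _ (max0 x)) gx := gc.
  apply: cvg_comp gx => W Wx.
  have := max_cont x _ Wx; rewrite /= !nbhs_filterE.
  by apply: (@filterS _ (nbhs x)) => y; apply; exact: max0.
have h_int (u : R) : lebesgue_measure.-integrable `[-1, u] (EFin \o h).
  apply: continuous_compact_integrable; first exact: segment_compact.
  exact: continuous_subspaceT.
pose F (x : R) := \int[lebesgue_measure]_(s in `[-1, x]) h s.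
exists (fun x => F x - F 0) => x x0.
  have x1 : -1 < x by rewrite (lt_le_trans _ x0)// ltrN10.
  have xx1 : x < x + 1 by rewrite ltrDl.
  have [dF F'] := continuous_FTC1_closed xx1 (h_int _) x1 (h_cont x).
  rewrite -[g x]subr0; apply: is_deriveB.
  by apply: DeriveDef => //; rewrite -derive1E F' hg.
rewrite /F Rintegral_itvB ?bnd_simp//.
rewrite Rintegral_itv_obnd_cbnd; last first.
  apply: integrableS (h_int x) => //; apply: subset_itvr.
  by rewrite bnd_simp ltW// ltrN10.
apply: eq_Rintegral => s; rewrite inE/= in_itv/= => /andP[s0 _].
exact: hg.
Qed.

End RealCalculus.

Section HilbertCalculus.
Variables (R : realType) (H : completeNormedModType R).
Variable ip : {dot H for idfun}.
Hypothesis ip_norm : induces_norm ip.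

Lemma cvg_dot {T : Type} (F : set_system T) {FF : Filter F} (x y : T -> H)
    (a c : H) : x @ F --> a -> y @ F --> c ->
  (ip (x s) (y s) : R) @[s --> F] --> (ip a c : R).
Proof.
(* The polarization identity reduces the claim to the continuity of the norm. *)
have polE z w : ip z w = 4^-1 * (`|z + w| ^+ 2 - `|z - w| ^+ 2).
  by rewrite -!(dotE ip_norm) !dotDl !dotDr !(dotNl, dotNr) [ip w z]dotC; field.
move=> xa yc; rewrite polE; under eq_fun do rewrite polE.
apply: cvgMr; apply: cvgB; rewrite expr2; under eq_fun do rewrite expr2.
- by apply: cvgM; apply: cvg_norm; apply: cvgD.
- by apply: cvgM; apply: cvg_norm; apply: cvgB.
Qed.

End HilbertCalculus.

Section Gronwall.
Variable R : realType.

(** The differential inequality [E' >= - c b E], integrated with the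
    integrating factor [exp (c \int b)]. *)
Lemma gronwall_lower_bound (c : R) (b B E dE : R -> R) :
  (forall t : R, 0 <= t -> is_derive t 1 B (b t)) -> B 0 = 0 ->
  (forall t : R, 0 < t -> is_derive t 1 E (dE t)) -> E @ 0^'+ --> E 0 ->
  (forall t : R, 0 < t -> 0 <= dE t + c * b t * E t) ->
  forall t : R, 0 <= t -> E 0 <= E t * expR (c * B t).
Proof.
move=> dB B0 dE' E_cont dE_ge t; rewrite le_eqVlt => /predU1P[<-|t0].
  by rewrite B0 mulr0 expR0 mulr1.
pose W (s : R) := expR (c * B s).
have dW (s : R) : 0 <= s -> is_derive s 1 W (W s * (c * b s)).
  move=> s0; have dBs := dB _ s0.
  exact: (@is_derive1_comp _ expR (fun r => c * B r)).
have dEW (s : R) : 0 < s ->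
    is_derive s 1 (E * W) (W s * (dE s + c * b s * E s)).
  move=> s0; have dEs := dE' _ s0; have dWs := dW _ (ltW s0).
  apply: is_derive_eq.
  by rewrite /GRing.scale/=; ring.
have W_cont (s : R) : 0 <= s -> {for s, continuous W}.
  move=> /dW[dWs _]; exact/differentiable_continuous/derivable1_diffP.
have EW_cont : {within `[0, t], continuous (E * W)}.
  apply/continuous_within_itvP => //; split.
  - move=> s; rewrite in_itv/= => /andP[s0 _].
    have [dEWs _] := dEW _ s0.
    exact/differentiable_continuous/derivable1_diffP.
  - by apply: cvgM => //; apply/cvg_at_right_filter/W_cont.
  - apply/cvg_at_left_filter/differentiable_continuous/derivable1_diffP.
    by have [] := dEW _ t0.
have : (E * W) 0 <= (E * W) t.
  apply: (ger0_derive1_le_cc _ _ EW_cont); rewrite ?in_itv/= ?lexx ?ltW//.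
  - by move=> s; rewrite in_itv/= => /andP[s0 _]; have [] := dEW _ s0.
  - move=> s; rewrite in_itv/= => /andP[s0 _]; have [_] := dEW _ s0.
    by rewrite derive1E => ->; rewrite mulr_ge0 ?expR_ge0// dE_ge.
have W0 : W 0 = 1 by rewrite /W B0 mulr0 expR0.
by rewrite -[(E * W) 0]/(E 0 * W 0) W0 mulr1.
Qed.

Lemma limf_einf_pinfty_ge (f : R -> R) (r : R) :
  (forall t, 0 <= t -> r <= f t) ->
  (r%:E <= limf_einf (fun t => (f t)%:E) (pinfty_nbhs R))%E.
Proof.
move=> fr; rewrite limf_einfE.
apply: (@le_trans _ _ (ereal_inf [set (f x)%:E | x in [set t | 0 <= t]])).
  by apply: le_ereal_inf_tmp => _ [t /= t0 <-]; rewrite lee_fin fr.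
apply: ereal_sup_ubound; exists [set t | 0 <= t] => //.
by exists 0; split => // x /ltW.
Qed.

End Gronwall.

Section HalfLineCalculus.
Variables (R : realType) (H : completeNormedModType R).
Implicit Types (u v x y : R -> H) (t : R).

Local Notation at_half t := (within `[0%R, +oo[ t^').

Lemma at_halfP t (P : R -> Prop) :
  (forall s, 0 <= s -> s != t -> P s) -> \forall s \near at_half t, P s.
Proof.
move=> tP.
suff : \forall s \near t, s != t -> `[0, +oo[%classic s -> P s by [].
apply: (@filterE _ (nbhs t)) => s st.
by rewrite /= in_itv/= andbT => s0; exact: tP.
Qed.

Lemma at_half_eq_cvg {U : topologicalType} (f g : R -> U) t (l : U) :
  (forall s, 0 <= s -> s != t -> f s = g s) ->
  f @ at_half t --> l -> g @ at_half t --> l.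
Proof.
move=> fg; apply: cvg_trans; apply: near_eq_cvg.
by apply: at_halfP => s s0 st; rewrite fg.
Qed.

Lemma at_right_at_half t : 0 <= t -> t^'+ --> at_half t.
Proof.
move=> t0 P; apply: (@filterS _ (nbhs t)) => s /= + ts; apply.
  by rewrite gt_eqF.
by rewrite /= in_itv/= andbT (le_trans t0)// ltW.
Qed.

Lemma at_half_proper t : 0 <= t -> ProperFilter (at_half t).
Proof.
move=> t0; apply: Build_ProperFilter_ex => P /(at_right_at_half t0).
exact: filter_ex.
Qed.

Lemma is_derive_half_cvg u v t : is_derive_half (whole_space H) u v ->
  0 <= t -> (s - t)^-1 *: (u s - u t) @[s --> at_half t] --> v t.
Proof.
move=> duv t0; have [_ [_ /=]] := duv t t0.
by move/norm_cvg0/subr_cvg0.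
Qed.

Lemma derive_half_ext x u v t : is_derive_half (whole_space H) u v ->
  (forall s, 0 <= s -> x s = u s) -> 0 <= t -> derive_half x t = v t.
Proof.
move=> duv xu t0; have ? := at_half_proper t0; apply/cvg_lim => //.
by apply: at_half_eq_cvg (is_derive_half_cvg duv t0) => s s0 st; rewrite !xu.
Qed.

Lemma graph_space_cvg (T : linear_operator H) u t :
  continuous_half (graph_space T) u -> 0 <= t ->
  T (u s) @[s --> at_half t] --> T (u t).
Proof.
move=> uT t0; have u_dom s : 0 <= s -> op_dom T (u s) by move=> /uT[].
have [_ /= /cvgr0Pnorm_lt u_cvg] := uT t t0.
apply/cvgrPdist_lt => e e0.
suff : \forall s \near t, s != t -> `[0, +oo[%classic s ->
  `|T (u t) - T (u s)| < e by [].
apply: (@filterS _ (nbhs t)) (u_cvg e e0) => s us _ s_half.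
have s0 : 0 <= s by move: s_half; rewrite /= in_itv/= andbT.
apply: le_lt_trans (us s_half); rewrite distrC -opB; [|exact: u_dom..].
by rewrite ger0_norm ?addr_ge0// lerDr.
Qed.

Lemma difference_quotient_cvg u (d : H) t :
  (s - t)^-1 *: (u s - u t) @[s --> at_half t] --> d ->
  u s @[s --> at_half t] --> u t.
Proof.
move=> ud.
have s_t : s - t @[s --> at_half t] --> (0 : R).
  apply: cvg_within_filter; apply: cvg_within_filter.
  by apply/subr_cvg0; exact: cvg_id.
apply/subr_cvg0; rewrite -(scale0r d).
apply: at_half_eq_cvg (cvgZ s_t ud) => s s0 st /=.
by rewrite scalerA mulfV ?scale1r// subr_eq0.
Qed.

Variable ip : {dot H for idfun}.
Hypothesis ip_norm : induces_norm ip.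

(** Derivative of a quadratic quantity [g] whose increments factor as
    [g s - g t = <x s - x t, y s + y t>]; only [x] has to be differentiable. *)
Lemma is_derive_quadratic (g : R -> R) x y (dx : R -> H) :
  (forall s t, 0 <= s -> 0 <= t -> g s - g t = ip (x s - x t) (y s + y t)) ->
  (forall t, 0 <= t ->
    (s - t)^-1 *: (x s - x t) @[s --> at_half t] --> dx t) ->
  (forall t, 0 <= t -> y s @[s --> at_half t] --> y t) ->
  (forall t, 0 < t -> is_derive t 1 g (2 * ip (dx t) (y t))) /\
  g @ 0^'+ --> g 0.
Proof.
move=> g_incr x_diff y_cont; split => [t t0|].
  apply: is_derive_difference_quotient; rewrite -(half_line_dnbhs t0).
  have -> : 2 * ip (dx t) (y t) = ip (dx t) (y t + y t).
    by rewrite dotDr; ring.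
  have y2 : y s + y t @[s --> at_half t] --> y t + y t.
    by apply: cvgD; [exact: y_cont (ltW t0)|exact: cvg_cst].
  have : ip ((s - t)^-1 *: (x s - x t)) (y s + y t) @[s --> at_half t] -->
      (ip (dx t) (y t + y t) : R).
    by apply: (cvg_dot ip_norm _ y2); exact: x_diff (ltW t0).
  apply: at_half_eq_cvg => s s0 st.
  by rewrite /= linearZl_LR/= g_incr// ltW.
apply: cvg_trans (cvg_fmap2 (at_right_at_half (lexx 0))) _.
have x0 := difference_quotient_cvg (x_diff 0 (lexx 0)).
have y2 : y s + y 0 @[s --> at_half (0 : R)] --> y 0 + y 0.
  by apply: cvgD; [exact: y_cont|exact: cvg_cst].
have : ip (x s - x 0) (y s + y 0) @[s --> at_half (0 : R)] -->
    (ip 0 (y 0 + y 0) : R).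
  by apply: (cvg_dot ip_norm _ y2); exact/subr_cvg0.
rewrite linear0l => g0; apply/subr_cvg0.
by apply: at_half_eq_cvg g0 => s s0 st; rewrite g_incr.
Qed.

End HalfLineCalculus.

(** * The damped equation *)

Unset Implicit Arguments.

Theorem theorem4p1 (R : realType) (H : completeNormedModType R)
  (ip : {dot H for idfun}) (ip_norm : induces_norm ip) (H_sep : separable H)
  (A : linear_operator H)
  (A_sa : self_adjoint ip A) (A_ge0 : nonnegative_op ip A)
  (Ahalf : linear_operator H) (AhalfP : is_power ip A (2^-1) Ahalf)
  (m : R -> R) (m_cont : {within `[0, +oo[, continuous m})
  (m_ge0 : forall s, 0 <= s -> 0 <= m s)
  (b : R -> R) (b_cont : {within `[0, +oo[, continuous b})
  (b_gt0 : forall s, 0 <= s -> 0 < b s)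
  (b_int : (\int[lebesgue_measure]_(s in `[0%R, +oo[) (b s)%:E < +oo)%E)
  (u0 u1 : H) (u0_dom : op_dom A u0) (u1_dom : op_dom Ahalf u1)
  (nondeg : 0 < `|u1| ^+ 2
    + \int[lebesgue_measure]_(s in `[0, `|Ahalf u0| ^+ 2]) m s)
  (eps : R) (eps_gt0 : 0 < eps)
  (u : R -> H)
  (u_C2 : Ck_half 2 (whole_space H) u)
  (u_C1 : Ck_half 1 (graph_space Ahalf) u)
  (u_C0 : Ck_half 0 (graph_space A) u)
  (u_eq : forall t, 0 <= t ->
    eps *: derive_half (derive_half u) t + b t *: derive_half u t
    + m (`|Ahalf (u t)| ^+ 2) *: A (u t) = 0)
  (u_init0 : u 0 = u0) (u_init1 : derive_half u 0 = u1) :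
  (0 < limf_einf
         (fun t : R => (`|derive_half u t| ^+ 2 + `|Ahalf (u t)| ^+ 2)%:E)
         (pinfty_nbhs R))%E.
Proof.
have [v du [w dv _]] := u_C2.
have uA t : 0 <= t -> op_dom A (u t) by move=> /u_C0[].
have uAhalf t : 0 <= t -> op_dom Ahalf (u t).
  by have [v' du' _] := u_C1; move=> /du'[].
have v_eq t : 0 <= t -> derive_half u t = v t.
  by move=> t0; apply: (derive_half_ext du).
have ode t : 0 <= t -> eps *: w t + b t *: v t
    + m (`|Ahalf (u t)| ^+ 2) *: A (u t) = 0.
  by move=> t0; rewrite -(derive_half_ext dv v_eq t0) -v_eq// u_eq.
have [M dM ME] := half_line_primitive m_cont.
have [B dB BE] := half_line_primitive b_cont.
have M0 : M 0 = 0 by rewrite ME// set_itv1 Rintegral_set1.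
have B0 : B 0 = 0 by rewrite BE// set_itv1 Rintegral_set1.
have M_ge0 s : 0 <= s -> 0 <= M s.
  move=> s0; rewrite ME//; apply: Rintegral_ge0 => r.
  by rewrite /= in_itv/= => /andP[r0 _]; exact: m_ge0.
(* The energy is [En = eps * K + M \o P], with [M] the primitive of [m]; its
   derivative [dEn] is [- 2 b K] by the equation. *)
pose K t := ip (v t) (v t); pose P t := ip (Ahalf (u t)) (Ahalf (u t)).
have K_ge0 t : 0 <= K t by exact: dot_ge0.
have P_ge0 t : 0 <= P t by exact: dot_ge0.
have [dK K_cvg] :
    (forall t : R, 0 < t -> is_derive t 1 K (2 * ip (w t) (v t))) /\
    K @ 0^'+ --> K 0.
  apply: (is_derive_quadratic ip_norm (x := v)) => [s t _ _|t t0|t t0].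
  - exact: dot_sqr_sub.
  - exact: is_derive_half_cvg.
  - exact: (difference_quotient_cvg (is_derive_half_cvg dv t0)).
have [dP P_cvg] :
    (forall t : R, 0 < t -> is_derive t 1 P (2 * ip (v t) (A (u t)))) /\
    P @ 0^'+ --> P 0.
  apply: (is_derive_quadratic ip_norm (x := u) (y := A \o u)).
  - move=> s t s0 t0; apply: (sqrt_op_sub A_sa A_ge0 AhalfP); by auto.
  - by move=> t t0; exact: is_derive_half_cvg.
  - by move=> t t0; exact: graph_space_cvg.
pose En t := eps * K t + M (P t).
pose dEn t := eps * (2 * ip (w t) (v t)) + m (P t) * (2 * ip (v t) (A (u t))).
have dEnE t : 0 <= t -> dEn t = - (2 * b t * K t).
  move=> t0; have := congr1 (ip (v t)) (ode t t0).
  rewrite linear0r !dotDr !linearZr_LR/= -(dotE ip_norm) -/(P t) -/(K t).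
  by rewrite /dEn [ip (w t) _]dotC => h; lra.
have dEn' (t : R) : 0 < t -> is_derive t 1 En (dEn t).
  move=> t0; have dKt := dK t t0; have dPt := dP t t0.
  have dMt := dM _ (P_ge0 t).
  exact: is_deriveD.
have M_cont (s : R) : 0 <= s -> {for s, continuous M}.
  by move=> /dM[dMs _]; exact/differentiable_continuous/derivable1_diffP.
have En_cvg : En @ 0^'+ --> En 0.
  apply: cvgD; first exact: cvgMr.
  exact: (cvg_comp _ _ P_cvg (M_cont _ (P_ge0 0))).
have En_ge t : 0 <= t -> En 0 <= En t * expR (2 / eps * B t).
  apply: (gronwall_lower_bound dB B0 dEn' En_cvg) => {}t t0.
  rewrite (dEnE t (ltW t0)) /En.
  have -> : - (2 * b t * K t) + 2 / eps * b t * (eps * K t + M (P t)) =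
    2 / eps * b t * M (P t) by field; rewrite gt_eqF.
  apply: mulr_ge0; last exact: M_ge0.
  by rewrite mulr_ge0 ?divr_ge0 ?(ltW eps_gt0)// ltW// b_gt0// ltW.
(* The nondegeneracy assumption, up to the factor [eps] of the kinetic term. *)
have En0 : 0 < En 0.
  have := nondeg; rewrite -u_init1 -u_init0 v_eq// -!(dotE ip_norm).
  rewrite -/(K 0) -/(P 0) -ME// /En.
  have := K_ge0 0; rewrite le_eqVlt => /predU1P[<-|K0 _].
    by rewrite mulr0.
  by rewrite ltr_pwDl ?mulr_gt0// M_ge0.
pose L := fine (\int[lebesgue_measure]_(s in `[0%R, +oo[) (b s)%:E)%E.
have B_le t : 0 <= t -> B t <= L.
  move=> t0; rewrite BE// /L /Rintegral.
  have b_ge0 (s : R) : `[0, +oo[%classic s -> (0 <= (b s)%:E)%E.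
    by rewrite /= in_itv/= andbT lee_fin => /b_gt0/ltW.
  have sub (s : R) : `[0, t]%classic s -> `[0, +oo[%classic s.
    by rewrite /= !in_itv/= andbT => /andP[].
  have le_int : (\int[lebesgue_measure]_(s in `[0%R, t]) (b s)%:E <=
      \int[lebesgue_measure]_(s in `[0%R, +oo[) (b s)%:E)%E.
    apply: ge0_subset_integral => //; apply/measurable_EFinP.
    exact: subspace_continuous_measurable_fun.
  apply: fine_le => //.
  - rewrite ge0_fin_numE; first exact: le_lt_trans le_int b_int.
    by apply: integral_ge0 => s /sub; exact: b_ge0.
  - by rewrite ge0_fin_numE//; exact: integral_ge0.
pose e := En 0 * expR (- (2 / eps * L)).
have e0 : 0 < e by rewrite mulr_gt0 ?expR_gt0.
have En_e t : 0 <= t -> e <= En t.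
  move=> t0; rewrite /e expRN ler_pdivrMr ?expR_gt0//.
  apply: le_trans (En_ge t t0) _; apply: ler_wpM2l.
    by rewrite addr_ge0 ?M_ge0// mulr_ge0// ltW.
  by rewrite ler_expR ler_wpM2l ?B_le// divr_ge0// ltW.
have [d d0 Md] : exists2 d, 0 < d & forall s, 0 <= s -> s < d -> M s < e / 2.
  have /cvgrPdist_lt/(_ (e / 2)) := M_cont 0 (lexx 0).
  rewrite divr_gt0// M0 => /(_ isT)[d /= d0 dM'].
  exists d => // s s0 sd; have := dM' s.
  by rewrite /= !sub0r !normrN !ger0_norm ?M_ge0//; apply.
(* If [K t + P t < r], then [P t < d] and [eps * K t < e / 2] give
   [En t < e]. *)
pose r := Num.min d (e / (2 * eps)).
have r0 : 0 < r by rewrite lt_min d0 divr_gt0// mulr_gt0.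
apply: (@lt_le_trans _ _ r%:E); first by rewrite lte_fin.
apply: limf_einf_pinfty_ge => t t0; rewrite v_eq// -!(dotE ip_norm).
rewrite -/(K t) -/(P t) leNgt; apply/negP => lt_r.
have Pd : P t < d.
  by apply: (le_lt_trans _ (lt_le_trans lt_r _)); rewrite ?lerDr// ge_min lexx.
have Ke : K t < e / (2 * eps).
  apply: (le_lt_trans _ (lt_le_trans lt_r _)); rewrite ?lerDl//.
  by rewrite ge_min lexx orbT.
have := En_e t t0; rewrite leNgt => /negP; apply.
have := Md _ (P_ge0 t) Pd; rewrite /En.
move: Ke; rewrite ltr_pdivlMr ?mulr_gt0// => Ke Me.
by lra.
Qed.
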